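(* $$\sup_{(X,Y)\in\mathcal C_{\mathcal I}}\mathbb E|X-Y|^{2}=\sup_{n\in\mathbb Z_+}\ \sup_{G\in\mathcal B(n,n)}\ \frac1{n^{4}}\sum_{i,j=1}^{n}|\deg(x_i)-\deg(y_j)|^{2}.$$
   Context: A pair $(X,Y)$ of random variables on a common probability space $(\Omega,\mathcal F,\mathbb P)$ is called coherent if there exist an event $A\in\mathcal F$ and sub-$\sigma$-fields $\mathcal G,\mathcal H\subset\mathcal F$ such that $X=\mathbb P(A|\mathcal G)$ and $Y=\mathbb P(A|\mathcal H)$. $\mathcal C_{\mathcal I}$ denotes the family of all coherent pairs $(X,Y)$ (over all probability spaces, events and sub-$\sigma$-fields) with $X$ and $Y$ independent. $\mathbb Z_+$ is the set of positive integers. $\mathcal B(n,n)$ is the set of all bipartite simple graphs whose vertex set is the disjoint union of two $n$-element groups $\{x_1,\dots,x_n\}\cup\{y_1,\dots,y_n\}$, every edge joining some $x_i$ to some $y_j$; $\deg(v)$ is the degree of the vertex $v$ in the graph. *)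

(* Defs.v *)
From HB Require Import structures.
From mathcomp Require Import all_boot all_order all_algebra.
From mathcomp Require Import all_classical all_reals all_analysis.

Set Implicit Arguments.
Unset Strict Implicit.
Unset Printing Implicit Defensive.

Import Order.TTheory GRing.Theory Num.Theory.
Import numFieldNormedType.Exports.

Local Open Scope classical_set_scope.
Local Open Scope ring_scope.

Definition sub_sigma_field d (T : measurableType d) (G : set (set T)) : Prop :=
  sigma_algebra [set: T] G /\ G `<=` measurable.

(* [X] is a version of the conditional probability P(A | G); like every
   conditional expectation, it is determined only up to P-null sets. *)
Definition is_cond_prob d (T : measurableType d) (R : realType)
    (P : probability T R) (A : set T) (G : set (set T)) (X : T -> R) : Prop :=
  [/\ forall B : set R, measurable B -> G (X @^-1` B),
      P.-integrable [set: T] (EFin \o X) &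
      forall B : set T, G B -> (\int[P]_(w in B) (X w)%:E = P (A `&` B))%E].

Definition coherent d (T : measurableType d) (R : realType)
    (P : probability T R) (X Y : {RV P >-> R}) : Prop :=
  exists (A : set T) (G H : set (set T)),
    [/\ measurable A, sub_sigma_field G, sub_sigma_field H,
        is_cond_prob P A G X & is_cond_prob P A H Y].

Definition independent_RV d (T : measurableType d) (R : realType)
    (P : probability T R) (X Y : {RV P >-> R}) : Prop :=
  forall B C : set R, measurable B -> measurable C ->
    (P (X @^-1` B `&` Y @^-1` C) = P (X @^-1` B) * P (Y @^-1` C))%E.

(* The values E|X - Y|^2 for (X, Y) in C_I: the existential ranges over all
   probability spaces (T, measurable, P). *)
Definition coherent_indep_values (R : realType) : set (\bar R) :=
  [set v | exists (d : measure_display) (T : measurableType d)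
             (P : probability T R) (X Y : {RV P >-> R}),
     [/\ coherent X Y, independent_RV X Y &
         v = ('E_P[(fun w => `|X w - Y w| ^+ 2)%R])%E]].

Arguments coherent_indep_values R : clear implicits.

Definition simple_graph (V : finType) (e : rel V) : Prop :=
  symmetric e /\ irreflexive e.

Definition deg (V : finType) (e : rel V) (v : V) : nat := #|[pred w | e v w]|.

(* B(n, n): the vertex x_i is [inl i] and the vertex y_j is [inr j]. *)
Definition bipartite_graph (n : nat) (e : rel ('I_n + 'I_n)%type) : Prop :=
  [/\ simple_graph e,
      forall i j : 'I_n, ~~ e (inl i) (inl j) &
      forall i j : 'I_n, ~~ e (inr i) (inr j)].

Definition normalized_deg_diff (R : realType) (n : nat)
    (e : rel ('I_n + 'I_n)%type) : R :=
  (n%:R ^+ 4)^-1 *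
  \sum_(i < n) \sum_(j < n) `|(deg e (inl i))%:R - (deg e (inr j))%:R| ^+ 2.

Arguments normalized_deg_diff R {n} e.

(* Main.v *)
Require Import Defs.
From HB Require Import structures.
From mathcomp Require Import all_boot all_order all_algebra.
From mathcomp Require Import all_classical all_reals all_analysis.
From mathcomp Require Import measurable_realfun.
From mathcomp Require Import lra.

Set Implicit Arguments.
Unset Strict Implicit.
Unset Printing Implicit Defensive.

Import Order.TTheory GRing.Theory Num.Theory.
Import numFieldNormedType.Exports.

Local Open Scope classical_set_scope.
Local Open Scope ring_scope.

(* For independent X and Y, splitting the ranges of X and Y into short
   intervals replaces E|X - Y|^2, up to an arbitrarily small error, by
     sum_(a, b) u_a v_b (x_a - y_b)^2,
     x_a = sum_b v_b g_ab,  y_b = sum_a u_a g_ab,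
   where u and v are the laws of the cells and g_ab in [0, 1] is the
   conditional probability of A on the product cell (a, b).  When u, v and g
   are rational this number is attained by a graph: blow up each product cell
   into a biregular bipartite graph of density g_ab, with circulant blocks.
   Density of the rationals then gives one inequality.  Conversely, a graph is
   an event in the uniform space of pairs (i, j), and the conditional
   probabilities of this event given i and given j are the normalized
   degrees. *)

(** * Graphs with prescribed block densities *)

Definition graph_sup (R : realType) : \bar R :=
  ereal_sup [set s : \bar R | exists2 n : nat, (0 < n)%N &
    s = ereal_sup [set (normalized_deg_diff R e)%:E
                    | e in [set e : rel ('I_n + 'I_n)%type | bipartite_graph e]]].

(** Translation by [s] permutes the residues modulo [M.+1], so the count does not depend on [s]. The
    case [h = M.+1] is included because blocks of density 1 occur. *)
Lemma card_shift_lt (M h : nat) (s : 'I_M.+1) : (h <= M.+1)%N ->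
  (\sum_(t < M.+1) ((s + t)%R < h)%N)%N = h.
Proof.
move=> hM; rewrite (reindex_inj (addrI (- s))).
under eq_bigr do rewrite addNKr.
rewrite -big_mkcond /= sum1_card.
transitivity #|[set widen_ord hM x | x : 'I_h]%SET|; last first.
  by rewrite card_imset ?card_ord// => x y /(congr1 val) /= ?; exact/val_inj.
apply: eq_card => t; rewrite unfold_in.
apply/idP/imsetP => [th|[x _ ->]]; last exact: (ltn_ord x).
by exists (Ordinal th) => //; apply/val_inj.
Qed.

Lemma big_enum_val_cast (K : nmodType) (V : finType) n (cV : #|V| = n) (F : V -> K) :
  \sum_(i < n) F (enum_val (cast_ord (esym cV) i)) = \sum_v F v.
Proof.
rewrite [RHS](reindex (fun i => enum_val (cast_ord (esym cV) i))) //.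
exists (fun v => cast_ord cV (enum_rank v)) => x _.
  by rewrite enum_valK cast_ordKV.
by rewrite cast_ordK enum_rankK.
Qed.

Section graph_of_relation.
Variables (n : nat) (V W : finType) (cV : #|V| = n) (cW : #|W| = n).
Variable r : V -> W -> bool.

Let vx (i : 'I_n) : V := enum_val (cast_ord (esym cV) i).
Let wy (j : 'I_n) : W := enum_val (cast_ord (esym cW) j).

(** The sides are arbitrary finite types, numbered by enumeration, so that they can be built as
    unions of cells. *)
Definition graph_of_rel : rel ('I_n + 'I_n)%type := fun p q =>
  match p, q with
  | inl i, inr j | inr j, inl i => r (vx i) (wy j)
  | _, _ => false
  end.

Lemma graph_of_rel_bipartite : bipartite_graph graph_of_rel.
Proof. by split=> //; split=> [] [i|i] // [j|j]. Qed.

Lemma normalized_deg_diff_graph_of_rel (R : realType) :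
  normalized_deg_diff R graph_of_rel = (n%:R ^+ 4)^-1 *
  \sum_v \sum_w ((\sum_w' r v w')%:R - (\sum_v' r v' w)%:R) ^+ 2.
Proof.
rewrite /normalized_deg_diff; congr (_ * _).
have degl i : deg graph_of_rel (inl i) = (\sum_w r (vx i) w)%N.
  rewrite /deg -sum1_card big_mkcond big_sumType /= big1 ?add0n//.
  rewrite -(big_enum_val_cast cW (fun w => r (vx i) w : nat)).
  by apply: eq_bigr => j _; rewrite !inE /=; case: r.
have degr j : deg graph_of_rel (inr j) = (\sum_v r v (wy j))%N.
  rewrite /deg -sum1_card big_mkcond big_sumType /= [X in (_ + X)%N]big1 ?addn0//.
  rewrite -(big_enum_val_cast cV (fun v => r v (wy j) : nat)).
  by apply: eq_bigr => i _; rewrite !inE /=; case: r.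
rewrite -(big_enum_val_cast cV); apply: eq_bigr => i _.
rewrite -(big_enum_val_cast cW); apply: eq_bigr => j _.
by rewrite degl degr real_normK// num_real.
Qed.

End graph_of_relation.

Definition weighted_value (R : pzRingType) (I J : finType) (u : I -> R) (v : J -> R)
    (g : I -> J -> R) : R :=
  \sum_a \sum_b u a * v b * (\sum_b' v b' * g a b' - \sum_a' u a' * g a' b) ^+ 2.

Lemma le_graph_sup (R : realType) n (e : rel ('I_n + 'I_n)%type) :
  (0 < n)%N -> bipartite_graph e ->
  ((normalized_deg_diff R e)%:E <= graph_sup R)%E.
Proof.
move=> n0 be; apply: le_trans; last by apply: ereal_sup_ubound; exists n.
by apply: ereal_sup_ubound; exists e.
Qed.

Lemma big_tagged_ord (K : nmodType) (I : finType) (n : I -> nat) (F : I -> K) :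
  \sum_(x : {a : I & 'I_(n a)}) F (tag x) = \sum_a F a *+ n a.
Proof.
transitivity (\sum_a \sum_(i < n a) F a); last first.
  by apply: eq_bigr => a _; rewrite sumr_const card_ord.
rewrite (sig_big_dep _ (fun a (i : 'I_(n a)) => true) (fun a i => F a)) /=.
by apply: eq_bigl.
Qed.

Lemma big_tagged_ord_prod (K : nmodType) (I : finType) (n : I -> nat) (M : nat)
    (F : I -> K) :
  \sum_(x : {a : I & 'I_(n a)} * 'I_M) F (tag x.1) = \sum_a F a *+ (n a * M).
Proof.
rewrite -(pair_bigA _ (fun (y : {a : I & 'I_(n a)}) (t : 'I_M) => F (tag y))) /=.
under eq_bigr do rewrite sumr_const card_ord.
rewrite (big_tagged_ord n (fun a => F a *+ M)).
by apply: eq_bigr => a _; rewrite -mulrnA mulnC.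
Qed.

(** Algebra of the blow-up: cells of [n * e] and [m * e] vertices out of [N * e] have weights
    [n / N] and [m / N], whatever the number [e] of copies. *)
Lemma scaled_sqr_diff (K : realFieldType) (N e x y m n : K) : e != 0 ->
  ((N * e) ^+ 4)^-1 * ((x - y) ^+ 2 * (m * e) * (n * e)) =
  n / N * (m / N) * (x / (N * e) - y / (N * e)) ^+ 2.
Proof.
move=> /mulVf e1; rewrite -mulrBl -exprVn invfM.
move: N^-1 e^-1 (x - y) e1 => c d z de.
(* The inverses are now variables tied only by [d * e = 1]; with [(d * e) ^+ 2] split off, what
   remains on each side is a polynomial identity. *)
transitivity (c ^+ 4 * d ^+ 2 * z ^+ 2 * m * n * (d * e) ^+ 2); first by lra.
by rewrite de; lra.
Qed.

(** With [M.+1] copies of every element, density [h a b / M.+1] means [h a b] neighbours among the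
    copies of one element. Degrees divided by the side size [N * M.+1] are then the weighted means.
    Both weights have denominator [N] since the two sides of the graph have equal size. *)
Lemma weighted_value_nat_le (R : realType) (I J : finType) (N M : nat)
    (n : I -> nat) (m : J -> nat) (h : I -> J -> nat) :
  (0 < N)%N -> (\sum_a n a = N)%N -> (\sum_b m b = N)%N ->
  (forall a b, h a b <= M.+1)%N ->
  ((weighted_value (fun a => (n a)%:R / N%:R) (fun b => (m b)%:R / N%:R)
     (fun a b => (h a b)%:R / M.+1%:R))%:E <= graph_sup R)%E.
Proof.
move=> N0 sn sm hM.
(* The M.+1 copies of an element of a cell are indexed by residues, and the
   test [s + t < h] on residues makes each block circulant, so that every row
   and every column of a block has the same density. *)
pose V := ({a : I & 'I_(n a)} * 'I_M.+1)%type.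
pose W := ({b : J & 'I_(m b)} * 'I_M.+1)%type.
have cV : #|{: V}| = (N * M.+1)%N.
  by rewrite card_prod card_ord card_tagged sumnE big_image/= -sn;
    congr (_ * _)%N; apply: eq_bigr => a _; rewrite card_ord.
have cW : #|{: W}| = (N * M.+1)%N.
  by rewrite card_prod card_ord card_tagged sumnE big_image/= -sm;
    congr (_ * _)%N; apply: eq_bigr => a _; rewrite card_ord.
pose r (x : V) (y : W) := ((x.2 + y.2)%R < h (tag x.1) (tag y.1))%N.
have := le_graph_sup R _ (graph_of_rel_bipartite cV cW r).
rewrite muln_gt0 N0 => /(_ isT); congr (_%:E <= _)%E.
rewrite normalized_deg_diff_graph_of_rel.
have rowE x : (\sum_w r x w)%N = (\sum_b m b * h (tag x.1) b)%N.
  transitivity (\sum_(y : {b : J & 'I_(m b)}) h (tag x.1) (tag y))%N.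
    rewrite -(pair_bigA _ (fun y t => r x (y, t) : nat)) /=.
    by apply: eq_bigr => y _; rewrite -[RHS](card_shift_lt x.2).
  rewrite (big_tagged_ord m (h (tag x.1))).
  by apply: eq_bigr => b _; rewrite -mulr_natr natn mulrC.
have colE y : (\sum_v r v y)%N = (\sum_a n a * h a (tag y.1))%N.
  transitivity (\sum_(x : {a : I & 'I_(n a)}) h (tag x) (tag y.1))%N.
    rewrite -(pair_bigA _ (fun x s => r (x, s) y : nat)) /=.
    apply: eq_bigr => x _; rewrite -[RHS](card_shift_lt y.2)//.
    by apply: eq_bigr => s _; rewrite addrC.
  rewrite (big_tagged_ord n (h^~ (tag y.1))).
  by apply: eq_bigr => b _; rewrite -mulr_natr natn mulrC.
pose D a b : R := ((\sum_b' m b' * h a b')%N%:R - (\sum_a' n a' * h a' b)%N%:R) ^+ 2.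
transitivity (((N * M.+1)%N%:R ^+ 4)^-1 *
    (\sum_(x : V) \sum_(y : W) D (tag x.1) (tag y.1))).
  congr (_ * _); apply: eq_bigr => x _; apply: eq_bigr => y _.
  by rewrite rowE colE.
have -> : \sum_(x : V) \sum_(y : W) D (tag x.1) (tag y.1) =
    \sum_a \sum_b D a b *+ (m b * M.+1) *+ (n a * M.+1).
  rewrite (big_tagged_ord_prod _ _ (fun a => \sum_(y : W) D a (tag y.1))).
  by apply: eq_bigr => a _; rewrite (big_tagged_ord_prod _ _ (D a)) sumrMnl.
rewrite /weighted_value big_distrr/=; apply: eq_bigr => a _.
rewrite big_distrr/=; apply: eq_bigr => b _.
have -> : \sum_b' (m b')%:R / N%:R * ((h a b')%:R / M.+1%:R) =
    (\sum_b' m b' * h a b')%N%:R / (N%:R * M.+1%:R) :> R.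
  rewrite natr_sum big_distrl/=; apply: eq_bigr => b' _.
  by rewrite natrM mulf_div.
have -> : \sum_a' (n a')%:R / N%:R * ((h a' b)%:R / M.+1%:R) =
    (\sum_a' n a' * h a' b)%N%:R / (N%:R * M.+1%:R) :> R.
  rewrite natr_sum big_distrl/=; apply: eq_bigr => a' _.
  by rewrite natrM mulf_div.
rewrite /D -(mulr_natr _ (n a * _)) -(mulr_natr _ (m b * _)) !natrM.
apply: scaled_sqr_diff.
by rewrite pnatr_eq0.
Qed.

(** * Passage to real weights *)

Section weighted_value_cvg.
Context {R : realType}.

Lemma cvg_truncn_scale (x : R) : 0 <= x ->
  ((Num.truncn (x * k.+1%:R))%:R / k.+1%:R : R) @[k --> \oo] --> x.
Proof.
move=> x0; apply: (@squeeze_cvgr _ _ _ _ (fun k => x - harmonic k) (fun=> x)).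
- apply: nearW => k; have k0 : 0 < k.+1%:R :> R by [].
  have /truncn_itv/andP[h1 h2] : 0 <= x * k.+1%:R by rewrite mulr_ge0.
  rewrite /harmonic ler_pdivrMr// h1 andbT ler_pdivlMr// mulrBl mulVf ?gt_eqF//.
  by move: h2; rewrite -[ltRHS]natr1; lra.
- by rewrite -[X in _ --> X]subr0; apply: cvgB; [exact: cvg_cst|exact: cvg_harmonic].
- exact: cvg_cst.
Qed.

Lemma cvg_truncnS_scale (x : R) : 0 <= x ->
  ((Num.truncn (x * k.+1%:R)).+1%:R / k.+1%:R : R) @[k --> \oo] --> x.
Proof.
move=> x0; rewrite -[X in _ --> X]addr0.
under eq_cvg do rewrite -natr1 mulrDl mul1r.
by apply: cvgD; [exact: cvg_truncn_scale|exact: cvg_harmonic].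
Qed.

Lemma cvg_sum_fin (J : finType) (f : J -> nat -> R) (l : J -> R) :
  (forall j, f j k @[k --> \oo] --> l j) ->
  \sum_j f j k @[k --> \oo] --> \sum_j l j.
Proof. by move=> fl; apply: cvg_big => [|j _]; [exact: add_continuous|exact: fl]. Qed.

Lemma cvg_weighted_value (I J : finType) (u : nat -> I -> R) (v : nat -> J -> R)
    (g : nat -> I -> J -> R) (u0 : I -> R) (v0 : J -> R)
    (g0 : I -> J -> R) :
  (forall a, u k a @[k --> \oo] --> u0 a) ->
  (forall b, v k b @[k --> \oo] --> v0 b) ->
  (forall a b, g k a b @[k --> \oo] --> g0 a b) ->
  weighted_value (u k) (v k) (g k) @[k --> \oo] --> weighted_value u0 v0 g0.
Proof.
move=> hu hv hg; apply: cvg_sum_fin => a; apply: cvg_sum_fin => b.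
apply: cvgM; first exact: cvgM.
have h : \sum_b' v k b' * g k a b' - \sum_a' u k a' * g k a' b @[k --> \oo] -->
    \sum_b' v0 b' * g0 a b' - \sum_a' u0 a' * g0 a' b.
  by apply: cvgB; apply: cvg_sum_fin => c; exact: cvgM.
by rewrite expr2; under eq_cvg do rewrite expr2; exact: cvgM.
Qed.

(* The successor keeps the total nonzero without affecting the limit. *)
Let count (I : finType) (u : I -> R) k a := (Num.truncn (u a * k.+1%:R)).+1.

Let cvg_count (I : finType) (u : I -> R) a :
  (forall a, 0 <= u a) -> \sum_a u a = 1 ->
  ((count u k a)%:R / (\sum_a' count u k a')%N%:R : R) @[k --> \oo] --> u a.
Proof.
(* The limit is written over the total weight, which is 1, so that numerator and denominator, both
   divided by [k.+1], converge separately. *)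
move=> u0 u1; have -> : nbhs (u a) = nbhs (u a / \sum_a' u a') by rewrite u1 divr1.
have scaled k : (count u k a)%:R / (\sum_a' count u k a')%N%:R =
    (count u k a)%:R / k.+1%:R / \sum_a' (count u k a')%:R / k.+1%:R :> R.
  by rewrite -mulr_suml -natr_sum invf_div mulrA mulfVK// pnatr_eq0.
under eq_cvg do rewrite scaled.
apply: cvgM; first exact: cvg_truncnS_scale.
apply: cvgV; first by rewrite u1 oner_neq0.
by apply: cvg_sum_fin => a'; exact: cvg_truncnS_scale.
Qed.

Let sum_count_gt0 (I : finType) (u : I -> R) k :
  \sum_a u a = 1 -> (0 < \sum_a count u k a)%N.
Proof.
move=> u1; have [a _|I0] := pickP (fun _ : I => true).
  by rewrite (bigD1 a).
(* Over an empty index type the weights would sum to 0, not 1. *)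
by have := oner_neq0 R; rewrite -u1 [X in X != _]big_pred0 ?eqxx.
Qed.

(** Integer parts at scale [k.+1] give rational data converging to [u], [v] and [g]; the bound for
    rational data passes to the limit because [weighted_value] is continuous in them. *)
Lemma weighted_value_le (I J : finType) (u : I -> R) (v : J -> R) (g : I -> J -> R) :
  (forall a, 0 <= u a) -> (forall b, 0 <= v b) ->
  \sum_a u a = 1 -> \sum_b v b = 1 ->
  (forall a b, 0 <= g a b <= 1) ->
  ((weighted_value u v g)%:E <= graph_sup R)%E.
Proof.
move=> u0 v0 u1 v1 g01.
pose U k := (\sum_a count u k a)%N; pose V k := (\sum_b count v k b)%N.
have U0 k : (0 < U k)%N by exact: sum_count_gt0.
have V0 k : (0 < V k)%N by exact: sum_count_gt0.
pose w k := weighted_value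
  (fun a => (count u k a)%:R / (U k)%:R : R) (fun b => (count v k b)%:R / (V k)%:R)
  (fun a b => (Num.truncn (g a b * k.+1%:R))%:R / k.+1%:R).
have w_le k : ((w k)%:E <= graph_sup R)%E.
  (* Multiplying each family of counts by the total of the other gives both the total [U k * V k]
     without changing the quotients. *)
  have := @weighted_value_nat_le R I J (U k * V k) k
    (fun a => count u k a * V k)%N (fun b => count v k b * U k)%N
    (fun a b => Num.truncn (g a b * k.+1%:R)).
  rewrite muln_gt0 U0 V0 -!big_distrl/= (mulnC (V k)) => /(_ isT erefl erefl).
  have -> : (fun a => (count u k a * V k)%:R / (U k * V k)%:R) =
            (fun a => (count u k a)%:R / (U k)%:R) :> (I -> R).
    by apply/funext => a; rewrite !natrM -mulf_div divff ?mulr1// pnatr_eq0 -lt0n.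
  have -> : (fun b => (count v k b * U k)%:R / (U k * V k)%:R) =
            (fun b => (count v k b)%:R / (V k)%:R) :> (J -> R).
    apply/funext => a; rewrite mulnC !natrM -mulf_div divff ?mul1r//.
    by rewrite pnatr_eq0 -lt0n.
  apply=> a b; rewrite truncn_le_nat; case/andP: (g01 a b) => _ g1.
  rewrite (@le_lt_trans _ _ k.+1%:R)// ?ltr_nat//.
  by rewrite ler_piMl.
have w_cvg : (w k)%:E @[k --> \oo] --> (weighted_value u v g)%:E.
  apply: cvg_EFin; first exact: nearW.
  apply: cvg_weighted_value => [a|b|a b]; [exact: cvg_count|exact: cvg_count|].
  by apply: cvg_truncn_scale; case/andP: (g01 a b).
rewrite -(cvg_lim _ w_cvg)//; apply: lime_le; last exact: nearW.
by apply/cvg_ex; eexists; exact: w_cvg.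
Qed.

End weighted_value_cvg.

(** * Discretization of calibrated functions *)

Lemma fine_probabilityK d (T : measurableType d) (R : realType)
    (P : probability T R) (E : set T) : measurable E -> (fine (P E))%:E = P E.
Proof. by move=> mE; rewrite fineK// fin_num_measure. Qed.

Section probability_partition.
Context {d : measure_display} {T : measurableType d} {R : realType}.
Variable P : probability T R.

Local Notation pr E := (fine (P E)).

Let pr_ge0 E : 0 <= pr E.
Proof. exact: fine_ge0. Qed.

Let le_pr E F : measurable E -> measurable F -> E `<=` F -> pr E <= pr F.
Proof. by move=> mE mF EF; rewrite -lee_fin !fine_probabilityK// le_measure// inE. Qed.

Definition measurable_partition (I : finType) (U : I -> set T) :=
  [/\ forall i, measurable (U i), trivIset [set: I] U & forall w, exists i, U i w].

Lemma ge0_integral_partition (I : finType) (U : I -> set T) (D : set T)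
    (f : T -> \bar R) :
  measurable_partition U -> measurable D -> measurable_fun [set: T] f ->
  (forall w, 0 <= f w)%E ->
  (\int[P]_(w in D) f w = \sum_i \int[P]_(w in D `&` U i) f w)%E.
Proof.
move=> [mU tU cU] mD mf f0.
have DE : D = \big[setU/set0]_(i <- index_enum I) (D `&` U i).
  rewrite -bigcup_seq; apply/seteqP; split=> [w Dw|w [i _ []]//].
  by have [i Uiw] := cU w; exists i => //=; rewrite mem_index_enum.
rewrite [in LHS]DE ge0_integral_bigsetU//.
- by move=> i; exact: measurableI.
- exact: index_enum_uniq.
- exact: trivIset_setIl (sub_trivIset _ tU).
- exact: measurable_funTS.
Qed.

Lemma measure_partition (I : finType) (U : I -> set T) (E : set T) :
  measurable_partition U -> measurable E ->
  fine (P E) = \sum_i fine (P (E `&` U i)).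
Proof.
move=> pU mE; have [mU _ _] := pU.
apply/EFin_inj; rewrite fine_probabilityK// -sumEFin.
have := ge0_integral_partition pU mE (measurable_cst 1%E) (fun=> lee01).
rewrite integral_cst// mul1e => ->; apply: eq_bigr => i _.
by rewrite integral_cst ?mul1e ?fine_probabilityK//; exact: measurableI.
Qed.

(** Take for [g] the conditional probability of [A] on product cells. Independence makes the
    denominator equal to the probability of the cell, so [g] is at most 1, and total probability
    over one partition turns the weighted means of [g] into the conditional probabilities of [A] on
    the cells of the other. *)
Lemma partition_value_le (I J : finType) (U : I -> set T) (V : J -> set T) (A : set T) :
  measurable_partition U -> measurable_partition V -> measurable A ->
  (forall a b, P (U a `&` V b) = P (U a) * P (V b))%E ->
  ((\sum_a \sum_b pr (U a) * pr (V b) *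
     (pr (A `&` U a) / pr (U a) - pr (A `&` V b) / pr (V b)) ^+ 2)%:E <= graph_sup R)%E.
Proof.
move=> pU pV mA iUV; have [mU _ _] := pU; have [mV _ _] := pV.
have prUV a b : pr (U a `&` V b) = pr (U a) * pr (V b).
  by apply/EFin_inj; rewrite EFinM !fine_probabilityK//; exact: measurableI.
have mAU a : measurable (A `&` U a) by exact: measurableI.
have mAV b : measurable (A `&` V b) by exact: measurableI.
have mUV a b : measurable (U a `&` V b) by exact: measurableI.
have mAUV a b : measurable (A `&` (U a `&` V b)) by exact: measurableI.
have le_AUV a b : pr (A `&` (U a `&` V b)) <= pr (U a) * pr (V b).
  by rewrite -prUV le_pr//; exact: subIsetr.
pose g a b := pr (A `&` (U a `&` V b)) / (pr (U a) * pr (V b)).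
have gK a b : pr (U a) * pr (V b) * g a b = pr (A `&` (U a `&` V b)).
  (* On a null product cell [g] is 0 by the convention for division, and the right-hand side
     vanishes too, being bounded by the cell. *)
  rewrite /g mulrC; have [uv0|uv0] := eqVneq (pr (U a) * pr (V b)) 0; last by rewrite divfK.
  by apply/esym/le_anti; rewrite uv0 mulr0 pr_ge0 andbT -uv0 le_AUV.
apply: (@le_trans _ _
  (weighted_value (fun a => pr (U a)) (fun b => pr (V b)) g)%:E); last first.
  apply: weighted_value_le => //.
  - have := measure_partition pU measurableT.
    by rewrite probability_setT /= => ->; apply: eq_bigr => a _; rewrite setTI.
  - have := measure_partition pV measurableT.
    by rewrite probability_setT /= => ->; apply: eq_bigr => a _; rewrite setTI.
  - move=> a b; rewrite /g divr_ge0 ?mulr_ge0//=.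
    have [->|uv0] := eqVneq (pr (U a) * pr (V b)) 0; first by rewrite invr0 mulr0.
    by rewrite ler_pdivrMr ?mul1r// lt_def uv0 mulr_ge0.
rewrite lee_fin le_eqVlt; apply/orP; left; apply/eqP.
apply: eq_bigr => a _; apply: eq_bigr => b _.
have [->|u0] := eqVneq (pr (U a)) 0; first by rewrite !mul0r.
have [->|v0] := eqVneq (pr (V b)) 0; first by rewrite mulr0 !mul0r.
congr (_ * (_ - _) ^+ 2).
  apply: (mulIf u0); rewrite divfK// (measure_partition pV (mAU a)) mulr_suml.
  by apply: eq_bigr => b' _; rewrite -setIA -gK; lra.
apply: (mulIf v0); rewrite divfK// (measure_partition pU (mAV b)) mulr_suml.
by apply: eq_bigr => a' _; rewrite -setIA (setIC (V b)) -gK; lra.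
Qed.

End probability_partition.

(** In the factored difference of the two squares, one factor is at most [2 * e] and the other at
    most 2 in absolute value. *)
Lemma sqr_diff_perturb (R : realFieldType) (e x y p q : R) :
  0 <= x <= 1 -> 0 <= y <= 1 -> 0 <= p <= 1 -> 0 <= q <= 1 ->
  `|x - p| <= e -> `|y - q| <= e -> (x - y) ^+ 2 <= (p - q) ^+ 2 + 4 * e.
Proof.
move=> x01 y01 p01 q01 xp yq; rewrite -lerBlDl subr_sqr.
apply: le_trans (ler_norm _) _; rewrite normrM.
have h1 : `|x - y - (p - q)| <= 2 * e.
  by move: xp yq; rewrite !ler_norml; lra.
have h2 : `|x - y + (p - q)| <= 2 by rewrite ler_norml; lra.
apply: le_trans (ler_pM _ _ h1 h2) _ => //; lra.
Qed.

Section bins.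
Context {d : measure_display} {T : measurableType d} {R : realType}.
Variables (k : nat) (X : T -> R).

(** The intervals are half-open, so the value 1 falls in one more interval, of index [k.+1]; hence
    [k.+2] bins. *)
Definition bin (a : 'I_k.+2) : set T :=
  X @^-1` `[a%:R / k.+1%:R, a.+1%:R / k.+1%:R[%classic.

Lemma binE a w : bin a w -> a%:R / k.+1%:R <= X w < a.+1%:R / k.+1%:R.
Proof. by rewrite /bin /= in_itv. Qed.

Hypothesis X01 : forall w, 0 <= X w <= 1.

(** The bin containing [w] is indexed by the integer part of [X w * k.+1], which yields both
    disjointness and covering. *)
Lemma bin_partition : measurable_fun [set: T] X -> measurable_partition bin.
Proof.
move=> mX; have k0 : 0 < k.+1%:R :> R by [].
split.
- by move=> a; rewrite -[X in measurable X]setTI; exact: mX.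
- have truncn_bin (a : 'I_k.+2) w : bin a w -> Num.truncn (X w * k.+1%:R) = a.
    move=> /binE/andP[aX Xa]; apply: truncn_def.
    by rewrite -ler_pdivrMr// aX/= -ltr_pdivlMr.
  move=> a b _ _ [w [aw bw]]; apply/val_inj => /=.
  by rewrite -(truncn_bin _ _ aw) -(truncn_bin _ _ bw).
- move=> w; have /andP[X0 X1] := X01 w.
  have lt_k : (Num.truncn (X w * k.+1%:R) < k.+2)%N.
    rewrite ltnS truncn_le_nat (@le_lt_trans _ _ k.+1%:R)// ?ltr_nat//.
    by rewrite ler_piMl.
  exists (Ordinal lt_k); rewrite /bin /= in_itv /=.
  by rewrite ler_pdivrMr// ltr_pdivlMr//; apply: truncn_itv; rewrite mulr_ge0.
Qed.

End bins.

Section calibrated.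
Context {d : measure_display} {T : measurableType d} {R : realType}.
Variable P : probability T R.
Local Notation pr E := (fine (P E)).

(* The consequence of X = P(A | G) that no longer mentions G: conditioning A
   on X itself gives X back. *)
Definition calibrated (A : set T) (X : T -> R) :=
  measurable_fun [set: T] X /\
  forall B : set R, measurable B ->
    (\int[P]_(w in X @^-1` B) (X w)%:E = P (A `&` X @^-1` B))%E.

(** The condition of [independent_RV] on bare functions, so that it can be stated for compositions
    with [clamp]. *)
Definition indep_fun (X Y : T -> R) :=
  forall B C : set R, measurable B -> measurable C ->
    (P (X @^-1` B `&` Y @^-1` C) = P (X @^-1` B) * P (Y @^-1` C))%E.

(** By calibration, the conditional probability of [A] on a bin is the average of [X] there. It
    therefore lies between the same two end points as [X w], at distance [k.+1%:R^-1] from each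
    other. *)
Lemma calibrated_bin (A : set T) (X : T -> R) k (a : 'I_k.+2) w :
  measurable A -> calibrated A X -> (forall w, 0 <= X w <= 1) ->
  pr (bin X a) != 0 -> bin X a w ->
  `|X w - pr (A `&` bin X a) / pr (bin X a)| <= k.+1%:R^-1 /\
  0 <= pr (A `&` bin X a) / pr (bin X a) <= 1.
Proof.
move=> mA [mX cX] X01 u0 aw.
have [mU _ _] := bin_partition k X01 mX.
have mUa := mU a; set u := pr (bin X a) in u0 *; set x := pr (A `&` bin X a).
have u_gt0 : 0 < u by rewrite lt_def u0 fine_ge0.
have mfX : measurable_fun (bin X a) (EFin \o X).
  by apply/measurable_EFinP; exact: measurable_funTS.
have xE : (\int[P]_(w in bin X a) (X w)%:E = x%:E)%E.
  by rewrite cX ?fine_probabilityK//; exact: measurableI.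
have lb : a%:R / k.+1%:R * u <= x.
  rewrite -lee_fin -xE EFinM fine_probabilityK// -integral_cst//.
  apply: ge0_le_integral => //.
  - by move=> v _; rewrite lee_fin divr_ge0.
  - by move=> v /binE/andP[]; rewrite lee_fin.
have ub : x <= a.+1%:R / k.+1%:R * u.
  rewrite -lee_fin -xE EFinM fine_probabilityK// -integral_cst//.
  apply: ge0_le_integral => //.
  - by move=> v _; rewrite lee_fin; case/andP: (X01 v).
  - by move=> v /binE/andP[_ /ltW]; rewrite lee_fin.
have x0 : 0 <= x by exact: fine_ge0.
have xu : x <= u.
  by rewrite -lee_fin !fine_probabilityK ?le_measure ?inE//; exact: measurableI.
split; last by rewrite divr_ge0 ?fine_ge0//= ler_pdivrMr ?mul1r.
rewrite -ler_pdivlMr// in lb; rewrite -ler_pdivrMr// in ub.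
have aS : a.+1%:R / k.+1%:R = a%:R / k.+1%:R + k.+1%:R^-1 :> R.
  by rewrite -[a.+1%:R]natr1 mulrDl mul1r.
have /andP[] := binE aw; rewrite aS in ub *; rewrite ler_norml => h1 h2.
clear -lb ub h1 h2.
move: (a%:R / k.+1%:R : R) (x / u) (k.+1%:R^-1 : R) (X w) lb ub h1 h2 => *.
by apply/andP; split; lra.
Qed.

Lemma calibrated_le (A : set T) (X Y : T -> R) : measurable A ->
  calibrated A X -> calibrated A Y -> indep_fun X Y ->
  (forall w, 0 <= X w <= 1) -> (forall w, 0 <= Y w <= 1) ->
  (\int[P]_w ((X w - Y w) ^+ 2)%:E <= graph_sup R)%E.
Proof.
move=> mA cX cY iXY X01 Y01; have [mX _] := cX; have [mY _] := cY.
suff approx (e : R) : 0 < e ->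
    (\int[P]_w ((X w - Y w) ^+ 2)%:E <= graph_sup R + e%:E)%E.
  by apply/lee_addgt0Pr => e; exact: approx.
move=> e0.
(* Bins of length at most [e / 4] make the error [4 * k.+1%:R^-1] of [sqr_diff_perturb] at most
   [e]. *)
pose k := Num.truncn (4 / e).
have ke : 4 * k.+1%:R^-1 <= e.
  by rewrite ler_pdivrMr// mulrC -ler_pdivrMr// ltW// truncnS_gt.
have pU := bin_partition k X01 mX; have [mU _ _] := pU.
have pV := bin_partition k Y01 mY; have [mV _ _] := pV.
have mUV (a b : 'I_k.+2) : measurable (bin X a `&` bin Y b) by exact: measurableI.
have iUV (a b : 'I_k.+2) : (P (bin X a `&` bin Y b) = P (bin X a) * P (bin Y b))%E.
  exact: iXY.
have le_S := partition_value_le pU pV mA iUV.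
apply: le_trans (leeD2r _ le_S).
have mf : measurable_fun [set: T] (fun w => ((X w - Y w) ^+ 2)%:E).
  by apply/measurable_EFinP; apply: measurable_funX; exact: measurable_funB.
have f0 w : (0 <= ((X w - Y w) ^+ 2)%:E)%E by rewrite lee_fin sqr_ge0.
rewrite (ge0_integral_partition P pU)//.
under eq_bigr => a _.
  rewrite (ge0_integral_partition P pV)//; last by rewrite setTI.
  under eq_bigr do rewrite setTI.
  over.
have tot : \sum_(a < k.+2) \sum_(b < k.+2) pr (bin X a) * pr (bin Y b) = 1 :> R.
  under eq_bigr => a _ do rewrite -mulr_sumr.
  rewrite -mulr_suml.
  have := measure_partition P pU measurableT; rewrite probability_setT/= => U1.
  have := measure_partition P pV measurableT; rewrite probability_setT/= => V1.
  under eq_bigr do rewrite -[bin X _]setTI.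
  rewrite -U1 mul1r V1.
  by apply: eq_bigr => b _; rewrite setTI.
(* The weights of the product cells sum to 1, so [e] is shared out among the cells in proportion to
   weight and the comparison is made cell by cell. *)
rewrite -EFinD -[in leRHS](mulr1 e) -[in leRHS]tot mulr_sumr -big_split/= -sumEFin.
apply: lee_sum => a _; rewrite mulr_sumr -big_split/= -sumEFin.
apply: lee_sum => b _.
set u := pr (bin X a); set v := pr (bin Y b).
set p := _ / u; set q := _ / v.
have [u0|u0] := eqVneq u 0.
  rewrite u0 !mul0r mulr0 addr0 null_set_integral//; first exact: measurable_funTS.
  by apply: (eq_trans (iUV a b)); rewrite -(fine_probabilityK P (mU a)) -/u u0 mul0e.
have [v0|v0] := eqVneq v 0.
  rewrite v0 !mulr0 mul0r addr0 null_set_integral//; first exact: measurable_funTS.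
  by apply: (eq_trans (iUV a b)); rewrite -(fine_probabilityK P (mV b)) -/v v0 mule0.
have PUV : P (bin X a `&` bin Y b) = (u * v)%:E.
  by apply: (eq_trans (iUV a b)); rewrite EFinM !fine_probabilityK.
have -> : u * v * (p - q) ^+ 2 + e * (u * v) = ((p - q) ^+ 2 + e) * (u * v) by lra.
rewrite EFinM -PUV.
rewrite -integral_cst//; apply: ge0_le_integral => //.
- exact: measurable_funTS.
- move=> w [aw bw]; rewrite /cst lee_fin.
  have [Xp p01] := calibrated_bin mA cX X01 u0 aw.
  have [Yq q01] := calibrated_bin mA cY Y01 v0 bw.
  apply: le_trans (sqr_diff_perturb _ _ _ _ Xp Yq) _ => //.
  by rewrite lerD2l.
Qed.

End calibrated.

(** * Conditional probabilities as calibrated functions with values in [0, 1] *)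

Section clamp.
Context {d : measure_display} {T : measurableType d} {R : realType}.
Variable P : probability T R.

(* A version of a conditional probability lies in [0, 1] only almost surely;
   composing with clamp makes this hold everywhere and, acting on values only,
   preserves independence. *)
Definition clamp (x : R) : R := Num.max 0 (Num.min x 1).

Lemma clamp01 x : 0 <= clamp x <= 1.
Proof. by rewrite /clamp le_max lexx ge_max ler01 ge_min lexx orbT. Qed.

Lemma clampK x : 0 <= x <= 1 -> clamp x = x.
Proof. by move=> /andP[x0 x1]; rewrite /clamp min_l// max_r. Qed.

Lemma measurable_clamp : measurable_fun [set: R] clamp.
Proof. by apply: measurable_maxr => //; exact: measurable_minr. Qed.

(** The integral of [f], which is also that of its absolute value, must be 0; so [f] vanishes almost
    everywhere on [D], yet it vanishes nowhere there. *)
Lemma measure0_integral_le0 (D : set T) (f : T -> R) :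
  measurable D -> measurable_fun D f -> (forall w, D w -> 0 < f w) ->
  (\int[P]_(w in D) (f w)%:E <= 0)%E -> P D = 0%E.
Proof.
move=> mD mf f0 If.
have mf' : measurable_fun D (EFin \o f) by exact/measurable_EFinP.
have : (\int[P]_(w in D) `|(EFin \o f) w| = 0)%E.
  apply/le_anti; rewrite integral_ge0// andbT; apply: le_trans If.
  rewrite le_eqVlt; apply/orP; left; apply/eqP.
  by apply: eq_integral => w /set_mem Dw; rewrite gee0_abs// lee_fin ltW// f0.
move=> /(ae_eq_integral_abs P mD mf') [N [mN PN sub]].
apply: (subset_measure0 mD mN _ PN) => w Dw; apply: sub => /(_ Dw) /=.
by move=> [fw0]; have := f0 _ Dw; rewrite fw0 ltxx.
Qed.

(** The events [X < 0] and [X > 1] belong to [G], so [X] integrates over each to the probability of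
    its intersection with [A]. This is nonnegative and at most the probability of the event, which
    forces both events to be null. *)
Lemma cond_prob01_ae (A : set T) (G : set (set T)) (X : T -> R) :
  measurable A -> is_cond_prob P A G X ->
  {ae P, forall w, 0 <= X w <= 1}.
Proof.
move=> mA [GX /[dup] iX /measurable_int/measurable_EFinP mX cX].
have mN (B : set R) : measurable B -> measurable (X @^-1` B).
  by move=> mB; rewrite -[X @^-1` B]setTI; exact: mX.
have mlt0 := mN _ (measurable_itv (Interval -oo%O (BLeft (0 : R)))).
have mgt1 := mN _ (measurable_itv (Interval (BRight (1 : R)) +oo%O)).
have iD D : measurable D -> P.-integrable D (EFin \o X).
  by move=> mD; exact: integrableS iX.
have lt0 : P (X @^-1` `]-oo, 0[) = 0%E.
  apply: (@measure0_integral_le0 _ (fun w => - X w)) => //.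
  - exact/measurable_funTS/measurableT_comp.
  - by move=> w; rewrite /= in_itv/= oppr_gt0.
  - under eq_integral do rewrite EFinN.
    rewrite integralN; last by apply: integrable_add_def => //; exact: iD.
    by rewrite leeNl oppe0 cX//; apply: GX; exact: measurable_itv.
have gt1 : P (X @^-1` `]1, +oo[) = 0%E.
  apply: (@measure0_integral_le0 _ (fun w => X w - 1)) => //.
  - by apply/measurable_funTS/measurable_funB.
  - by move=> w; rewrite /= in_itv/= andbT subr_gt0.
  - under eq_integral do rewrite EFinB.
    rewrite integralB_EFin ?iD//=; last exact: finite_measure_integrable_cst.
    rewrite cX; last by apply: GX; exact: measurable_itv.
    rewrite integral_cst// mul1e leeBlDr ?fin_num_measure// add0e.
    by apply: le_measure; rewrite ?inE//; exact: measurableI.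
exists (X @^-1` `]-oo, 0[ `|` X @^-1` `]1, +oo[); split.
- exact: measurableU.
- by apply: null_set_setU.
- move=> w /= /negP; rewrite negb_and -!ltNge !in_itv/= andbT => /orP[]; by [left|right].
Qed.

Lemma calibrated_clamp (A : set T) (G : set (set T)) (X : T -> R) :
  measurable A -> sub_sigma_field G -> is_cond_prob P A G X ->
  calibrated P A (clamp \o X).
Proof.
move=> mA [_ Gm] cpX; have X01 := cond_prob01_ae mA cpX.
have [GX /measurable_int/measurable_EFinP mX cX] := cpX.
have mcX : measurable_fun [set: T] (clamp \o X).
  exact: measurableT_comp measurable_clamp mX.
split=> // B mB; rewrite comp_preimage.
have mcB : measurable (clamp @^-1` B).
  by rewrite -[X in measurable X]setTI; exact: measurable_clamp.
rewrite -cX; last exact: GX.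
apply: ae_eq_integral.
- exact/Gm/GX.
- by apply/measurable_EFinP; exact: measurable_funTS.
- by apply/measurable_EFinP; exact: measurable_funTS.
- by apply: filterS X01 => w X01 _ /=; rewrite clampK.
Qed.

Lemma coherent_le_graph_sup (X Y : {RV P >-> R}) :
  coherent X Y -> independent_RV X Y ->
  ('E_P[(fun w => `|X w - Y w| ^+ 2)%R] <= graph_sup R)%E.
Proof.
move=> [A [G [H [mA sG sH cX cY]]]] iXY.
have -> : ('E_P[(fun w => `|X w - Y w| ^+ 2)%R] =
    \int[P]_w ((clamp (X w) - clamp (Y w)) ^+ 2)%:E)%E.
  rewrite unlock; apply: ae_eq_integral => //.
  - apply/measurable_EFinP/measurable_funX/measurableT_comp => //.
    exact: measurable_funB.
  - apply/measurable_EFinP/measurable_funX/measurable_funB.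
      exact: measurableT_comp measurable_clamp _.
    exact: measurableT_comp measurable_clamp _.
  - have X01 := cond_prob01_ae mA cX; have Y01 := cond_prob01_ae mA cY.
    apply: filterS2 X01 Y01 => w X01 Y01 _.
    by rewrite !clampK// real_normK ?num_real.
apply: (@calibrated_le _ _ _ P A (clamp \o X) (clamp \o Y)) => //.
- exact: calibrated_clamp sG cX.
- exact: calibrated_clamp sH cY.
- move=> B C mB mC; apply: (iXY (clamp @^-1` B) (clamp @^-1` C)).
    by rewrite -[X in measurable X]setTI; exact: measurable_clamp.
  by rewrite -[X in measurable X]setTI; exact: measurable_clamp.
- by move=> w; exact: clamp01.
- by move=> w; exact: clamp01.
Qed.

End clamp.

(** * Graphs as events *)

Section uniform_nat.
Context {R : realType}.
Variable N : nat.

Let invr_N_ge0 : 0 <= N.+1%:R^-1 :> R. Proof. by rewrite invr_ge0. Qed.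

(** The uniform law on the integers from 0 to [N], as normalized Dirac masses. *)
Definition uniform_nat : set nat -> \bar R :=
  mscale (NngNum invr_N_ge0) (msum (fun k => \d_k) N.+1).

HB.instance Definition _ := Measure.on uniform_nat.

Lemma ge0_integral_uniform_nat (D : set nat) (f : nat -> R) : (forall k, 0 <= f k) ->
  (\int[uniform_nat]_(k in D) (f k)%:E =
   (N.+1%:R^-1 * \sum_(k < N.+1) \1_D (k : nat) * f k)%:E)%E.
Proof.
move=> f0.
rewrite ge0_integral_mscale//; last by move=> k _; rewrite lee_fin.
rewrite ge0_integral_measure_sum//; last by move=> k _; rewrite lee_fin.
rewrite EFinM -sumEFin; congr (_ * _)%E; apply: eq_bigr => k _.
by rewrite integral_dirac// EFinM.
Qed.

Let uniform_nat_setT : uniform_nat [set: nat] = 1%E.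
Proof.
have := ge0_integral_uniform_nat setT (fun=> ler01).
rewrite integral_cst// mul1e => ->; under eq_bigr do rewrite indicT mulr1.
by rewrite sumr_const card_ord mulVf// pnatr_eq0.
Qed.

HB.instance Definition _ :=
  Measure_isProbability.Build _ _ _ uniform_nat uniform_nat_setT.

End uniform_nat.

Section uniform_finite.
Context {R : realType} {V : finType} {N : nat}.
Variables (v0 : V) (cV : #|V| = N.+1).

(* The points of V are encoded as natural numbers because nat carries the
   discrete sigma-algebra, whereas a finite type has none by default. *)
Definition decode (k : nat) : V := nth v0 (enum V) k.

Lemma big_decode (K : nmodType) (F : V -> K) :
  \sum_(k < N.+1) F (decode k) = \sum_v F v.
Proof.
rewrite -[RHS]big_enum (big_nth v0) /= -(big_mkord xpredT (fun k => F (decode k))).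
by rewrite -cV cardE.
Qed.

Lemma integral_decode (S : V -> bool) (f : V -> R) : (forall v, 0 <= f v) ->
  (\int[uniform_nat N]_(k in [set k | S (decode k)]) (f (decode k))%:E =
   (N.+1%:R^-1 * \sum_(v | S v) f v)%:E)%E.
Proof.
move=> f0; rewrite ge0_integral_uniform_nat//; congr (_ * _)%:E.
rewrite [in RHS]big_mkcond -big_decode; apply: eq_bigr => k _.
rewrite indicE; case: ifPn => [Sk|nSk]; first by rewrite mem_set// mul1r.
by rewrite memNset ?mul0r//; exact/negP.
Qed.

Lemma uniform_decode (S : V -> bool) :
  uniform_nat N [set k | S (decode k)] = (N.+1%:R^-1 * \sum_v (S v)%:R : R)%:E.
Proof.
have := @integral_decode S (fun=> 1) (fun=> ler01).
rewrite integral_cst// mul1e => ->; congr (_ * _)%:E.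
by rewrite big_mkcond; apply: eq_bigr => v _; case: (S v).
Qed.

(** The events of [G] are the unions of fibres of [m] after decoding, so the identity defining a
    conditional probability follows by adding the hypothesis on [f] over fibres. *)
Lemma uniform_cond_prob (I : finType) (E : pred V) (m : V -> I) (f : I -> R) :
  (forall i, 0 <= f i) ->
  (forall i, \sum_(v | m v == i) f i = \sum_(v | m v == i) (E v)%:R) ->
  let G := [set [set k | S (m (decode k))] | S in [set: I -> bool]] in
  sub_sigma_field (G : set (set nat)) /\
  is_cond_prob (@uniform_nat R N) [set k | E (decode k)] G (fun k => f (m (decode k))).
Proof.
move=> f0 fE G; split; [split; last by []|split].
- split.
  + by exists (fun=> false) => //; apply/seteqP; split.
  + move=> _ [S _ <-]; exists (fun i => ~~ S i) => //.
    by rewrite setTD; apply/seteqP; split=> k /= /negP.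
  + move=> F GF.
    (* Each [F k] is a union of fibres, so it contains every fibre that it meets; the fibres met by
       some [F k] thus make up the union. *)
    exists (fun i => `[< exists k, F k `&` [set l | m (decode l) = i] !=set0 >]) => //.
    apply/seteqP; split=> [l /= /asboolP[k [l' [Fkl' ml']]]|l [k _ Fkl]].
      exists k => //; have [S _ FS] := GF k; move: Fkl'; rewrite -FS/= => Sl'.
      by rewrite -ml'.
    by apply/asboolP; exists k, l.
- move=> B mB; exists (fun i => `[< B (f i) >]) => //.
  by apply/seteqP; split=> k /= /asboolP.
- apply/integrableP; split => //.
  under eq_integral do rewrite /= ger0_norm//.
  have := @integral_decode (fun=> true) (fun v => f (m v)).
  by rewrite set_true => -> //; rewrite ltry.
- move=> _ [S _ <-].
  rewrite (@integral_decode (fun v => S (m v)) (fun v => f (m v)))//.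
  transitivity (@uniform_nat R N [set k | (E (decode k) && S (m (decode k)))]); last first.
    by congr (uniform_nat N _); apply/seteqP; split=> k /= /andP.
  rewrite (uniform_decode (fun v => E v && S (m v))); congr (_ * _)%:E.
  rewrite (partition_big m S)//= [RHS](partition_big m xpredT)//= [LHS]big_mkcond/=.
  apply: eq_bigr => i _; case: ifPn => Si.
    transitivity (\sum_(v | m v == i) f i).
      apply: eq_big => [v|v /andP[_ /eqP ->]//].
      by have [->|] := eqVneq (m v) i; rewrite ?Si ?andbF.
    by rewrite fE; apply: eq_bigr => v /eqP ->; rewrite Si andbT.
  by rewrite big1// => v /eqP ->; rewrite (negbTE Si) andbF.
Qed.

End uniform_finite.

Section graph_values.
Context {R : realType} {n : nat}.
Variable e : rel ('I_n.+1 + 'I_n.+1)%type.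
Hypothesis be : bipartite_graph e.

Let V := ('I_n.+1 * 'I_n.+1)%type.
(** The predecessor, because [uniform_nat N] charges [N.+1] points, one for each pair. *)
Let N := (n.+1 * n.+1).-1.
Let cV : #|{: V}| = N.+1. Proof. by rewrite card_prod !card_ord. Qed.
Let P : probability nat R := uniform_nat N.
Let dec : nat -> V := decode (ord0, ord0).
Let fx (i : 'I_n.+1) : R := (deg e (inl i))%:R / n.+1%:R.
Let fy (j : 'I_n.+1) : R := (deg e (inr j))%:R / n.+1%:R.
Let X (k : nat) := fx (dec k).1.
Let Y (k : nat) := fy (dec k).2.

Let mX : measurable_fun [set: nat] X. Proof. by []. Qed.
Let mY : measurable_fun [set: nat] Y. Proof. by []. Qed.

HB.instance Definition _ := isMeasurableFun.Build _ _ _ _ X mX.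
HB.instance Definition _ := isMeasurableFun.Build _ _ _ _ Y mY.

Let degl i : deg e (inl i) = (\sum_j e (inl i) (inr j))%N.
Proof.
have [_ nll _] := be.
rewrite /deg -sum1_card big_mkcond big_sumType /= big1 ?add0n => [|j _].
  by apply: eq_bigr => j _; rewrite unfold_in /=; case: e.
by rewrite unfold_in /= (negbTE (nll i j)).
Qed.

Let degr j : deg e (inr j) = (\sum_i e (inl i) (inr j))%N.
Proof.
have [[se _] _ nrr] := be.
rewrite /deg -sum1_card big_mkcond big_sumType /= [X in (_ + X)%N]big1 ?addn0 => [|i _].
  by apply: eq_bigr => i _; rewrite unfold_in /= se; case: e.
by rewrite unfold_in /= (negbTE (nrr j i)).
Qed.

Let sum_fst (F : V -> R) i : \sum_(v | v.1 == i) F v = \sum_j F (i, j).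
Proof.
transitivity (\sum_(i' | i' == i) \sum_j F (i', j)); last by rewrite big_pred1_eq.
by rewrite pair_big; apply: eq_big => [[a b]|[a b] _] //=; rewrite andbT.
Qed.

Let sum_snd (F : V -> R) j : \sum_(v | v.2 == j) F v = \sum_i F (i, j).
Proof.
transitivity (\sum_i \sum_(j' | j' == j) F (i, j')); last first.
  by apply: eq_bigr => i _; rewrite big_pred1_eq.
by rewrite pair_big; apply: eq_big => [[a b]|[a b] _].
Qed.

Lemma normalized_deg_diff_value :
  coherent_indep_values R (normalized_deg_diff R e)%:E.
Proof.
exists default_measure_display, nat, P, X, Y; split.
(* The event is that a uniformly drawn pair is an edge; its fibre sums over each coordinate are
   vertex degrees. *)
- pose E (v : V) := e (inl v.1) (inr v.2).
  have [||sG cX] := @uniform_cond_prob R V N (ord0, ord0) cV _ E fst fx.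
  + by move=> i; rewrite divr_ge0.
  + move=> i; rewrite !sum_fst sumr_const card_ord -natr_sum -degl.
    by rewrite /fx -[LHS]mulr_natr divfK// pnatr_eq0.
  have [||sH cY] := @uniform_cond_prob R V N (ord0, ord0) cV _ E snd fy.
  + by move=> i; rewrite divr_ge0.
  + move=> i; rewrite !sum_snd sumr_const card_ord -natr_sum -degr.
    by rewrite /fy -[LHS]mulr_natr divfK// pnatr_eq0.
  by eexists; eexists; eexists; split; [|exact: sG|exact: sH|exact: cX|exact: cY].
- move=> B C _ _.
  pose SB i := `[< B (fx i) >]; pose SC j := `[< C (fy j) >].
  rewrite (_ : X @^-1` B = [set k | SB (dec k).1]); last first.
    by apply/seteqP; split=> k /= /asboolP.
  rewrite (_ : Y @^-1` C = [set k | SC (dec k).2]); last first.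
    by apply/seteqP; split=> k /= /asboolP.
  rewrite (_ : _ `&` _ = [set k | SB (dec k).1 && SC (dec k).2]); last first.
    by apply/seteqP; split=> k /= /andP.
  have PS (S : V -> bool) : P [set k | S (dec k)] = (N.+1%:R^-1 * \sum_v (S v)%:R)%:E.
    exact: uniform_decode.
  have -> := PS (fun v => SB v.1 && SC v.2).
  have -> := PS (fun v => SB v.1).
  have -> := PS (fun v => SC v.2).
  rewrite -EFinM; congr _%:E.
  transitivity (N.+1%:R^-1 * \sum_i \sum_j (SB i)%:R * (SC j)%:R : R).
    by rewrite pair_big; congr (_ * _); apply: eq_bigr => v _; rewrite -natrM mulnb.
  have -> : \sum_(v : V) (SB v.1)%:R = n.+1%:R * \sum_i (SB i)%:R :> R.
    rewrite -(pair_bigA _ (fun i j => (SB i)%:R)) /= mulr_sumr.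
    by apply: eq_bigr => i _; rewrite sumr_const card_ord mulr_natl.
  have -> : \sum_(v : V) (SC v.2)%:R = n.+1%:R * \sum_j (SC j)%:R :> R.
    rewrite -(pair_bigA _ (fun i j => (SC j)%:R)) /=.
    by rewrite sumr_const card_ord mulr_natl.
  under eq_bigr do rewrite -mulr_sumr.
  rewrite -mulr_suml prednK// natrM.
  have N1 : (n.+1%:R * n.+1%:R)^-1 * (n.+1%:R * n.+1%:R) = 1 :> R.
    by rewrite mulVf// mulf_neq0// pnatr_eq0.
  move: (n.+1%:R : R) N1 => M; move: ((M * M)^-1) => K N1.
  set b := \sum_i _; set c := \sum_i _.
  (* The product of the two marginal probabilities differs from the joint one by the factor
     [K * (M * M)], which is 1. *)
  transitivity (K * (b * c) * (K * (M * M))); last by lra.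
  by rewrite N1 mulr1.
- rewrite unlock.
  transitivity (\int[P]_(k in [set k | true]) ((fx (dec k).1 - fy (dec k).2) ^+ 2)%:E)%E.
    rewrite (@integral_decode _ _ _ _ cV xpredT
      (fun v : V => (fx v.1 - fy v.2) ^+ 2)); last by move=> v; rewrite sqr_ge0.
    congr _%:E; rewrite -(pair_bigA _ (fun i j => (fx i - fy j) ^+ 2))/=.
    (* Of the four factors [n.+1%:R^-1], two are the weight of a pair and two come from squaring
       normalized degrees. *)
    rewrite /normalized_deg_diff prednK// natrM !mulr_sumr.
    apply: eq_bigr => i _; rewrite !mulr_sumr; apply: eq_bigr => j _.
    rewrite real_normK ?num_real// /fx /fy -mulrBl -exprVn invfM.
    by move: (n.+1%:R^-1) (_%:R - _%:R) => x y; lra.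
  rewrite set_true; apply: eq_integral => k _.
  by rewrite real_normK ?num_real.
Qed.

End graph_values.

Theorem corollary2p5 (R : realType) :
  ereal_sup (coherent_indep_values R) =
  ereal_sup [set s : \bar R | exists2 n : nat, (0 < n)%N &
    s = ereal_sup [set (normalized_deg_diff R e)%:E
                    | e in [set e : rel ('I_n + 'I_n)%type | bipartite_graph e]]].
Proof.
apply/le_anti/andP; split; apply: ge_ereal_sup => s.
- by move=> [d [T [P [X [Y [coXY iXY ->]]]]]]; exact: coherent_le_graph_sup.
- move=> [[//|n] _ ->]; apply: ge_ereal_sup => _ [e be <-].
  by apply: ereal_sup_ubound; exact: normalized_deg_diff_value.
Qed.
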